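(* For any graph $G$ with $n$ vertices, (i) $\gamma_{ir}(G) = n$ if and only if $G \simeq E_n$; (ii) $\gamma_{ir}(G) = n-1$ if and only if, for some integers $t \geq 0$ and $r \geq 1$, $G \simeq tK_1 \cup K_{1,r}$ or $G \simeq tK_1 \cup H$ for some $r$-regular graph $H$.
   Context: All graphs are finite, simple, undirected and have at least one vertex. $N(v)$ denotes the set of neighbours of a vertex $v$. A dominating set of $G$ is a set $D \subseteq V(G)$ such that every vertex in $V(G)\setminus D$ has a neighbour in $D$. An irregular dominating set of $G$ is a dominating set $D$ of $G$ such that $|N(u) \cap D| \neq |N(v) \cap D|$ for every two distinct vertices $u, v \in V(G) \setminus D$ (in particular, $V(G)$ is one). The irregular domination number $\gamma_{ir}(G)$ is the size of a smallest irregular dominating set of $G$. $\simeq$ denotes graph isomorphism, $E_n$ is the graph with $n$ vertices and no edges, $tK_1$ is the graph consisting of $t$ isolated vertices (no vertices if $t=0$), $K_{1,r}$ is the star with $r$ edges, and $\cup$ denotes vertex-disjoint union. *)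

(* Defs.v *)
From HB Require Import structures.
From mathcomp Require Import all_boot.

Set Implicit Arguments.
Unset Strict Implicit.
Unset Printing Implicit Defensive.

(** Finite simple undirected graphs.  The vertex set may be empty here, so that
    [edgeless 0] is a graph (the case t = 0 of tK_1); results about graphs with
    at least one vertex assume [0 < #|G|]. *)
Record sgraph := SGraph {
  vertex :> finType;
  adj : rel vertex;
  adj_sym : symmetric adj;
  adj_irrefl : irreflexive adj
}.

Definition nbhd (G : sgraph) (v : G) : {set G} := [set u | adj v u].

Definition dominating (G : sgraph) (D : {set G}) : bool :=
  [forall v in ~: D, exists u in D, adj v u].

Definition irregular_dominating (G : sgraph) (D : {set G}) : bool :=
  dominating D &&
  [forall u in ~: D, forall v in ~: D,
     (u != v) ==> (#|nbhd u :&: D| != #|nbhd v :&: D|)].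

Lemma irregular_dominating_setT (G : sgraph) :
  irregular_dominating [set: G].
Proof. by apply/andP; split; apply/forall_inP => v; rewrite !inE. Qed.

(** The minimum is over a nonempty family by [irregular_dominating_setT]. *)
Definition gamma_ir (G : sgraph) : nat :=
  #|[arg min_(D < [set: G] | irregular_dominating D) #|D|]|.

Definition isomorphic (G H : sgraph) : Prop :=
  exists2 f : G -> H, bijective f & forall u v, adj (f u) (f v) = adj u v.

Definition regular (r : nat) (G : sgraph) : Prop :=
  forall v : G, #|nbhd v| = r.

(** The edgeless graph on n vertices, that is, both E_n and nK_1. *)
Section Edgeless.
Variable n : nat.
Definition edgeless_adj : rel 'I_n := fun _ _ => false.
Fact edgeless_sym : symmetric edgeless_adj. Proof. by []. Qed.
Fact edgeless_irrefl : irreflexive edgeless_adj. Proof. by []. Qed.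
Definition edgeless : sgraph := SGraph edgeless_sym edgeless_irrefl.
End Edgeless.

(** The star K_{1,r}, with centre [None] and leaves [Some i]. *)
Section Star.
Variable r : nat.
Definition star_adj : rel (option 'I_r) := fun x y => isSome x != isSome y.
Fact star_sym : symmetric star_adj.
Proof. by move=> x y; rewrite /star_adj eq_sym. Qed.
Fact star_irrefl : irreflexive star_adj.
Proof. by move=> x; rewrite /star_adj eqxx. Qed.
Definition star : sgraph := SGraph star_sym star_irrefl.
End Star.

Section DisjointUnion.
Variables G H : sgraph.
Definition dunion_adj : rel (G + H) := fun x y =>
  match x, y with
  | inl u, inl v => adj u v
  | inr u, inr v => adj u v
  | _, _ => false
  end.
Fact dunion_sym : symmetric dunion_adj.
Proof. by move=> [u|u] [v|v] //=; rewrite adj_sym. Qed.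
Fact dunion_irrefl : irreflexive dunion_adj.
Proof. by move=> [u|u] /=; rewrite adj_irrefl. Qed.
Definition dunion : sgraph := SGraph dunion_sym dunion_irrefl.
End DisjointUnion.

(* Main.v *)
Require Import Defs.
From HB Require Import structures.
From mathcomp Require Import all_boot.
From mathcomp Require Import zify.

Set Implicit Arguments.
Unset Strict Implicit.
Unset Printing Implicit Defensive.

(** If D is irregular dominating and all non-isolated vertices have the same
    degree r, then v outside D has r minus its degree inside ~: D neighbours in
    D; so the subgraph induced on ~: D has pairwise distinct degrees, which
    forces at most one vertex.  Conversely, when two non-isolated vertices u, v
    have different degrees, V \ {u, v} is irregular, and it fails to be
    dominating only if u and v are adjacent and one of them is a leaf.  If this
    happens for every such pair, the non-isolated vertices form a star. *)

(** * Both extremal values characterised inside the graph, by degrees and adjacency *)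

Section Gamma.
Variable G : sgraph.
Implicit Types (u v w c : G) (D S : {set G}).

Lemma irregular_dominatingP D :
  reflect ((forall v, v \notin D -> 0 < #|nbhd v :&: D|) /\
           (forall u v, u \notin D -> v \notin D ->
              #|nbhd u :&: D| = #|nbhd v :&: D| -> u = v))
          (irregular_dominating D).
Proof.
apply: (iffP andP) => [[/forall_inP domD /forall_inP irrD]|[domD irrD]]; split.
- move=> v vD; have /domD/exists_inP[u uD vu] : v \in ~: D by rewrite inE.
  by apply/card_gt0P; exists u; rewrite !inE vu.
- move=> u v uD vD eq_uv; apply/eqP/negPn/negP => neq_uv.
  have /irrD/forall_inP/(_ v) : u \in ~: D by rewrite inE.
  by rewrite inE vD neq_uv eq_uv eqxx => /(_ isT).
- apply/forall_inP => v; rewrite inE => /domD /card_gt0P[u].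
  by rewrite !inE => /andP[vu uD]; apply/exists_inP; exists u.
- apply/forall_inP => u; rewrite inE => uD; apply/forall_inP => v.
  rewrite inE => vD; apply/implyP; apply: contra => /eqP eq_uv.
  by apply/eqP; apply: irrD.
Qed.

Lemma gamma_ir_le D : irregular_dominating D -> gamma_ir G <= #|D|.
Proof.
rewrite /gamma_ir; case: arg_minnP => [|D0 _ minD0 /minD0 //].
exact: irregular_dominating_setT.
Qed.

Lemma gamma_ir_attained :
  exists2 D : {set G}, irregular_dominating D & gamma_ir G = #|D|.
Proof.
rewrite /gamma_ir; case: arg_minnP => [|D irrD _]; last by exists D.
exact: irregular_dominating_setT.
Qed.

Lemma irregular_dominating_setC1 v :
  0 < #|nbhd v| -> irregular_dominating (~: [set v]).
Proof.
move=> /card_gt0P[w]; rewrite inE => vw; apply/irregular_dominatingP; split.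
- move=> u; rewrite !inE negbK => /eqP->; apply/card_gt0P; exists w.
  by rewrite !inE vw; apply: contraTneq vw => ->; rewrite adj_irrefl.
- by move=> x y; rewrite !inE !negbK => /eqP-> /eqP->.
Qed.

Lemma irregular_dominating_compl_gt0 D v :
  irregular_dominating D -> v \notin D -> 0 < #|nbhd v|.
Proof.
move=> /irregular_dominatingP[domD _] /domD vD.
by rewrite (leq_trans vD) // subset_leq_card // subsetIl.
Qed.

(** A non-isolated vertex can be left out of the full vertex set, whereas an isolated one lies in
    every dominating set. *)
Lemma gamma_ir_eq_card :
  gamma_ir G = #|G| <-> forall v, #|nbhd v| = 0.
Proof.
split=> [gG v | deg0].
  case: (posnP #|nbhd v|) => // /irregular_dominating_setC1/gamma_ir_le.
  rewrite gG cardsC1; have : 0 < #|G| by apply/card_gt0P; exists v.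
  by lia.
have [D irrD ->] := gamma_ir_attained; rewrite -cardsT; congr #|pred_of_set _|.
apply/setP => v; rewrite inE; apply: contraT => vD.
by have := irregular_dominating_compl_gt0 irrD vD; rewrite deg0.
Qed.

(** Intrinsic form of being some isolated vertices plus an [r]-regular graph. The first clause
    excludes edgeless graphs, where the second would hold vacuously for every [r]. *)
Definition regular_off_isolated r :=
  (exists v, 0 < #|nbhd v|) /\
  (forall v, 0 < #|nbhd v| -> #|nbhd v| = r).

(** Intrinsic form of being some isolated vertices plus a star: all edges pass through the centre
    [c]. *)
Definition star_off_isolated :=
  exists2 c, 0 < #|nbhd c| & forall u v, adj u v -> u = c \/ v = c.

Lemma card_nbhd_setI_lt u S : u \in S -> #|nbhd u :&: S| < #|S|.
Proof.
move=> uS; apply: proper_card; apply/properP; split; first exact: subsetIr.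
by exists u; rewrite // !inE adj_irrefl.
Qed.

(* Pigeonhole: the degrees would be exactly 0, ..., |S| - 1, but a vertex of
   degree |S| - 1 is adjacent to the one of degree 0. *)
Lemma induced_degrees_inj S :
  {in S &, injective (fun v => #|nbhd v :&: S|)} -> #|S| <= 1.
Proof.
move=> injS; rewrite leqNgt; apply/negP => S_gt1.
pose d (v : G) := #|nbhd v :&: S|.
have d_onto k : k < #|S| -> exists2 v, v \in S & d v = k.
  (* On [S] the default of [insubd] never occurs, since [d v < #|S|] there. An injection of [S] into
     ['I_#|S|] is then onto. *)
  move=> kS; pose e (v : G) : 'I_#|S| := insubd (Ordinal kS) (d v).
  have val_e v : v \in S -> val (e v) = d v.
    by move=> vS; rewrite val_insubd card_nbhd_setI_lt.
  have inj_e : {in S &, injective e}.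
    by move=> u v uS vS /(congr1 val); rewrite !val_e //; apply: injS.
  have eT : e @: S = [set: 'I_#|S|].
    by apply/eqP; rewrite eqEcard subsetT cardsT card_ord card_in_imset ?leqnn.
  have /imsetP[v vS ev] : Ordinal kS \in e @: S by rewrite eT inE.
  by exists v => //; rewrite -val_e // -ev.
have [u uS du] := d_onto 0 (ltnW S_gt1).
have [|v vS dv] := d_onto #|S|.-1; first by lia.
have neq_uv : u != v by apply/eqP => uv; move: dv; rewrite -uv du; lia.
have : nbhd v :&: S = S :\ v.
  apply/eqP; rewrite eqEcard; apply/andP; split.
    apply/subsetP => w; rewrite !inE => /andP[vw ->]; rewrite andbT.
    by apply: contraTneq vw => ->; rewrite adj_irrefl.
  by rewrite -/(d v) dv (cardsD1 v S) vS.
move/setP/(_ u); rewrite !inE uS neq_uv /= andbT => vu.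
have : v \in nbhd u :&: S by rewrite !inE adj_sym vu.
by rewrite (cards0_eq du) inE.
Qed.

Lemma regular_off_isolated_compl_le1 r D :
  regular_off_isolated r -> irregular_dominating D -> #|~: D| <= 1.
Proof.
move=> [_ regr] irrD; have degr v : v \in ~: D -> #|nbhd v| = r.
  by rewrite inE => /(irregular_dominating_compl_gt0 irrD)/regr.
have /irregular_dominatingP[_ irr] := irrD.
apply: induced_degrees_inj => u v uD vD eq_uv; have := uD; have := vD.
rewrite !inE => vD' uD'; apply: irr => //; move: (degr u uD) (degr v vD).
(* Both degrees equal [r], so equal counts in [~: D] give equal counts in [D]. *)
rewrite -(cardsID D (nbhd u)) -(cardsID D (nbhd v)) !setDE eq_uv.
by lia.
Qed.

(** A vertex outside [D] other than [c] can only be dominated by [c]. Hence [c] is in [D] as soon as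
    such a vertex exists, and two of them would both have exactly one neighbour in [D]. *)
Lemma star_off_isolated_compl_le1 D :
  star_off_isolated -> irregular_dominating D -> #|~: D| <= 1.
Proof.
move=> [c _ starc] /irregular_dominatingP[domD irrD].
have nb v : v \notin D -> v != c -> c \in D /\ nbhd v :&: D = [set c].
  move=> vD vc; have sub : nbhd v :&: D \subset [set c].
    apply/subsetP => w; rewrite !inE => /andP[/starc[] vw _].
      by rewrite vw eqxx in vc.
    by rewrite vw.
  have /card_gt0P[w wN] := domD v vD.
  move: (wN); have := subsetP sub w wN; rewrite !inE => /eqP wc.
  rewrite wc => /andP[vc' cD]; split=> //; apply/eqP; rewrite eqEsubset sub.
  by apply/subsetP => x; rewrite !inE => /eqP ->; rewrite vc' cD.
apply/card_le1P => u; rewrite inE => uD v; rewrite !inE.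
apply/idP/eqP => [vD|->//].
have [uc|uc] := eqVneq u c; have [vc|vc] := eqVneq v c.
- by rewrite uc.
- by have [cD _] := nb v vD vc; rewrite -uc (negbTE uD) in cD.
- by have [cD _] := nb u uD uc; rewrite -vc (negbTE vD) in cD.
- by apply: irrD => //; rewrite (nb u uD uc).2 (nb v vD vc).2.
Qed.

Lemma card_nbhd_setC2 u v :
  u != v -> #|nbhd u :&: ~: [set u; v]| = #|nbhd u| - adj u v.
Proof.
move=> neq_uv; rewrite (cardsD1 v (nbhd u)) inE addKn.
apply: eq_card => w; rewrite !inE negb_or andbC -andbA.
case: (eqVneq w u) => [->|//].
by rewrite adj_irrefl !andbF.
Qed.

(** With [adj u v] read as 0 or 1, the strict inequalities say that each of [u], [v] has a neighbour
    besides the other. Both degrees drop by the same [adj u v], so they stay distinct. *)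
Lemma irregular_dominating_setC2 u v :
    #|nbhd u| != #|nbhd v| -> adj u v < #|nbhd u| ->
  adj u v < #|nbhd v| -> irregular_dominating (~: [set u; v]).
Proof.
move=> neq_deg gtu gtv.
have neq_uv : u != v by apply: contraNneq neq_deg => ->.
have cu := card_nbhd_setC2 neq_uv.
have cv : #|nbhd v :&: ~: [set u; v]| = #|nbhd v| - adj u v.
  by rewrite setUC card_nbhd_setC2 1?eq_sym // adj_sym.
have degs : #|nbhd u| - adj u v <> #|nbhd v| - adj u v by lia.
apply/irregular_dominatingP; split.
  by move=> w; rewrite inE negbK !inE => /orP[]/eqP->; rewrite ?cu ?cv subn_gt0.
move=> x y; rewrite !(inE, negbK).
by move=> /orP[]/eqP-> /orP[]/eqP->; rewrite ?cu ?cv // => /esym.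
Qed.

Lemma regular_or_star :
    (forall D, irregular_dominating D -> #|~: D| <= 1) ->
    (exists v, 0 < #|nbhd v|) ->
  (exists2 r, 0 < r & regular_off_isolated r) \/ star_off_isolated.
Proof.
move=> small exv.
(* By [small], [u] and [v] cannot both be left out, so [irregular_dominating_setC2] must fail to
   apply. As [u] has the smaller degree, this forces [#|nbhd u| <= adj u v]. *)
have leaf u v : 0 < #|nbhd u| -> #|nbhd u| < #|nbhd v| ->
    #|nbhd u| = 1 /\ adj u v.
  move=> u_gt0 lt_uv; case: (ltnP (adj u v) #|nbhd u|) => [gt_u|]; last first.
    by case: (adj u v) u_gt0; lia.
  have neq_deg : #|nbhd u| != #|nbhd v| by rewrite ltn_eqF.
  have gt_v := ltn_trans gt_u lt_uv.
  have := small _ (irregular_dominating_setC2 neq_deg gt_u gt_v).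
  by rewrite setCK cards2; case: eqP lt_uv => [->|//]; rewrite ltnn.
have [c0 c0_gt0] := exv.
case: (@arg_maxnP _ c0 xpredT (fun v => #|nbhd v|)) => // c _ maxc.
have c_gt0 : 0 < #|nbhd c| := leq_trans c0_gt0 (maxc c0 isT).
case: (boolP [forall v : G, (0 < #|nbhd v|) ==> (#|nbhd v| == #|nbhd c|)]) =>
    [/forallP reg|].
  left; exists #|nbhd c| => //; split=> // v v_gt0.
  by apply/eqP; apply: (implyP (reg v)).
rewrite negb_forall => /existsP[u]; rewrite negb_imply => /andP[u_gt0 neq_uc].
have lt_uc : #|nbhd u| < #|nbhd c| by rewrite ltn_neqAle neq_uc; apply: maxc.
right; exists c => // x y xy.
have [u1 uc] := leaf u c u_gt0 lt_uc.
have x_gt0 : 0 < #|nbhd x| by apply/card_gt0P; exists y; rewrite inE.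
have [xc|] := eqVneq x c; [by left | move=> neq_xc; right].
(* If [x] had degree above 1, the leaf [u] would be adjacent to [x] as well as to [c]. *)
have x1 : #|nbhd x| = 1.
  case: (ltngtP #|nbhd x| 1) => [|x_gt1|//]; first by lia.
  have [|_ ux] := leaf u x u_gt0; first by rewrite u1.
  have /cards1P[z Nu] : #|nbhd u| == 1 by apply/eqP.
  move/setP: Nu => Nu; have := Nu x; have := Nu c; rewrite !inE ux uc.
  by move=> /esym/eqP cz /esym/eqP xz; rewrite xz cz eqxx in neq_xc.
(* Now [c] is the only neighbour of [x], so [y] is [c]. *)
have [|_ xc] := leaf x c x_gt0; first by rewrite x1 -u1.
have /cards1P[z /setP Nx] : #|nbhd x| == 1 by apply/eqP.
have := Nx y; have := Nx c; rewrite !inE xy xc.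
by move=> /esym/eqP-> /esym/eqP.
Qed.

Lemma gamma_ir_eq_card_sub1 : 0 < #|G| ->
  gamma_ir G = #|G| - 1 <->
  (exists2 r, 0 < r & regular_off_isolated r) \/ star_off_isolated.
Proof.
move=> G_gt0; split=> [gG | RS].
  apply: regular_or_star.
    by move=> D /gamma_ir_le; rewrite gG; have := cardsC D; lia.
  (* An edgeless graph has value [#|G|], which differs from the truncated [#|G| - 1] because [#|G|]
     is positive. *)
  apply/existsP; apply: contraPT gG; rewrite negb_exists => /forallP deg0.
  have /gamma_ir_eq_card -> : forall v, #|nbhd v| = 0.
    by move=> v; apply/eqP; rewrite -leqn0 leqNgt; apply: deg0.
  by lia.
have small D : irregular_dominating D -> #|~: D| <= 1.
  case: RS => [[r _ regr]|st]; first exact: regular_off_isolated_compl_le1 regr.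
  exact: star_off_isolated_compl_le1.
have [v v_gt0] : exists v, 0 < #|nbhd v|.
  by case: RS => [[r _ []]//|[c c_gt0 _]]; exists c.
have := gamma_ir_le (irregular_dominating_setC1 v_gt0); rewrite cardsC1.
have [D /small leD ->] := gamma_ir_attained.
by have := cardsC D; lia.
Qed.

End Gamma.

(** * From the intrinsic conditions to isomorphism with disjoint unions *)

Lemma isomorphic_edgeless (G : sgraph) n : #|G| = n ->
  isomorphic G (edgeless n) <-> forall v : G, #|nbhd v| = 0.
Proof.
move=> <-; split=> [[f _ fadj] v | deg0].
  by apply/eqP; rewrite cards_eq0; apply/eqP/setP => u; rewrite !inE -fadj.
exists enum_rank => [|u v]; first exact: enum_rank_bij.
by have /setP/(_ v) := cards0_eq (deg0 u); rewrite !inE.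
Qed.

Lemma isomorphic_card_nbhd (G H : sgraph) (f : G -> H) :
    bijective f -> (forall u v, adj (f u) (f v) = adj u v) ->
  forall v, #|nbhd (f v)| = #|nbhd v|.
Proof.
move=> bij_f fadj v; rewrite -(card_imset (nbhd v) (bij_inj bij_f)).
have [g fK gK] := bij_f; apply: eq_card => w.
by rewrite inE -[w]gK fadj mem_imset ?inE //; apply: bij_inj.
Qed.

(** The image of [k] contains every endpoint of an edge, so the vertices it misses are isolated, and
    [t] is their number. The isomorphism is the inverse of [h], which enumerates them on the left
    summand and is [k] on the right. *)
Lemma isomorphic_add_isolated (G K : sgraph) (k : K -> G) :
    injective k -> (forall x y, adj (k x) (k y) = adj x y) ->
    (forall u v : G, adj u v -> u \in codom k) ->
  exists t, isomorphic G (dunion (edgeless t) K).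
Proof.
move=> inj_k kadj isoG; pose A : {set G} := [set v | v \notin codom k].
exists #|A|; pose h (x : dunion (edgeless #|A|) K) : G :=
  match x with inl i => enum_val i | inr y => k y end.
have hA i : h (inl i) \notin codom k by have := enum_valP i; rewrite inE.
have inj_h : injective h.
  move=> [i|x] [j|y] //.
  - by move=> /enum_val_inj ->.
  - by move=> e; have := hA i; rewrite e /= codom_f.
  - by move=> e; have := hA j; rewrite -e /= codom_f.
  - by move=> /inj_k ->.
have bij_h : bijective h.
  apply: inj_card_bij => //; rewrite card_sum card_ord -(card_codom inj_k).
  by rewrite -(cardC [in codom k]) addnC leq_add2r /A cardsE.
have hadj x y : adj (h x) (h y) = adj x y.
  have inl_iso i v : adj (h (inl i)) v = false.
    by apply/negP => /isoG; rewrite (negbTE (hA i)).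
  case: x y => [i|x] [j|y] /=; rewrite ?inl_iso ?kadj //.
  by rewrite adj_sym inl_iso.
have [g hK gK] := bij_h; exists g; first by exists h.
by move=> u v; rewrite -hadj !gK.
Qed.

Section Induced.
Variables (G : sgraph) (A : {set G}).
Definition induced_adj : rel {x : G | x \in A} := fun x y => adj (val x) (val y).
Fact induced_sym : symmetric induced_adj.
Proof. by move=> x y; apply: adj_sym. Qed.
Fact induced_irrefl : irreflexive induced_adj.
Proof. by move=> x; apply: adj_irrefl. Qed.
Definition induced : sgraph := SGraph induced_sym induced_irrefl.
End Induced.

(** [H] is the subgraph induced on the non-isolated vertices. It contains all neighbours of its
    vertices, so degrees do not change. Conversely, [0 < r] makes the vertices of [H]
    non-isolated. *)
Lemma regular_off_isolatedP (G : sgraph) r : 0 < r ->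
  regular_off_isolated G r <->
  exists t, exists H : sgraph,
    [/\ 0 < #|H|, regular r H & isomorphic G (dunion (edgeless t) H)].
Proof.
move=> r_gt0; split=> [[[v0 v0_gt0] regr] |].
  pose A : {set G} := [set v | 0 < #|nbhd v|]; pose H := induced A.
  have AP u v : adj u v -> u \in A.
    by move=> uv; rewrite inE; apply/card_gt0P; exists v; rewrite inE.
  have [|u v|t isoG] :=
    isomorphic_add_isolated (val_inj : injective (val : H -> G)).
  - by [].
  - by move=> /AP uA; apply/codomP; exists (Sub u uA : {x | x \in A}).
  exists t, H; split=> //.
    by rewrite card_sig; apply/card_gt0P; exists v0; rewrite !inE.
  move=> x; rewrite -(card_imset _ (@val_inj _ _ {x | x \in A})).
  rewrite -(regr (val x)); last by have := valP x; rewrite inE.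
  apply: eq_card => w; rewrite inE; apply/imsetP/idP => [[y]|xw].
    by rewrite inE => xy ->.
  have wA : w \in A by apply: (AP w (val x)); rewrite adj_sym.
  by exists (Sub w wA : {x | x \in A}); rewrite ?inE.
move=> [t [H [/card_gt0P[x0 _] regH [f bij_f fadj]]]].
have degl i : #|nbhd (inl i : dunion (edgeless t) H)| = 0.
  by apply/eqP; rewrite cards_eq0; apply/eqP/setP => -[j|y]; rewrite !inE.
have degr x : #|nbhd (inr x : dunion (edgeless t) H)| = r.
  rewrite -(regH x) -(card_imset (nbhd x) (@inr_inj 'I_t H)).
  apply: eq_card => -[j|y]; rewrite inE; last first.
    by rewrite mem_imset ?inE //; apply: inr_inj.
  by apply/esym/negP => /imsetP[].
have degf := isomorphic_card_nbhd bij_f fadj.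
split=> [|v].
  have [g _ gK] := bij_f; exists (g (inr x0)).
  by rewrite -degf gK degr.
by rewrite -degf; case: (f v) => [i|x]; rewrite ?degl ?degr.
Qed.

Lemma star_off_isolatedP (G : sgraph) :
  star_off_isolated G <->
  exists t r, 0 < r /\ isomorphic G (dunion (edgeless t) (star r)).
Proof.
split=> [[c c_gt0 starc] | [t [r [r_gt0 [f bij_f fadj]]]]].
  (* The centre goes to [c] and the leaves enumerate its neighbours. Two leaves are not adjacent,
     since every edge contains [c]. *)
  pose k (x : star #|nbhd c|) : G := if x is Some i then enum_val i else c.
  have adjk i : adj c (k (Some i)) by have := enum_valP i; rewrite inE.
  have kc i : k (Some i) <> c.
    by move=> e; have := adjk i; rewrite e adj_irrefl.
  have [|||t isoG] := @isomorphic_add_isolated G _ k.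
  - move=> [i|] [j|] //.
    + by move=> /enum_val_inj ->.
    + by move=> /kc.
    + by move=> /esym/kc.
  - move=> [i|] [j|] /=; rewrite /star_adj /=.
    + by apply/negP => /starc[] /kc.
    + by rewrite adj_sym adjk.
    + exact: adjk.
    + exact: adj_irrefl.
  - move=> u v uv; apply/codomP.
    have [->|vc] := starc u v uv; first by exists None.
    have uN : u \in nbhd c by rewrite inE adj_sym -vc.
    by exists (Some (enum_rank_in uN u)); rewrite /= enum_rankK_in.
  by exists t, #|nbhd c|.
have [g fK gK] := bij_f; exists (g (inr None)).
  rewrite -(isomorphic_card_nbhd bij_f fadj) gK; apply/card_gt0P.
  by exists (inr (Some (Ordinal r_gt0))); rewrite inE.
move=> u v; rewrite -fadj -{2}[u]fK -{2}[v]fK.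
by case: (f u) (f v) => [i|[i|]] [j|[j|]] //; [right | left].
Qed.

Theorem theorem4p4 (G : sgraph) (n : nat) (G_gt0 : 0 < #|G|) (Gn : #|G| = n) :
  (gamma_ir G = n <-> isomorphic G (edgeless n)) /\
  (gamma_ir G = n - 1 <->
     exists t r : nat, 1 <= r /\
       (isomorphic G (dunion (edgeless t) (star r)) \/
        exists H : sgraph,
          [/\ 0 < #|H|, regular r H & isomorphic G (dunion (edgeless t) H)])).
Proof.
split.
  by rewrite (isomorphic_edgeless Gn) -Gn; apply: gamma_ir_eq_card.
rewrite -Gn; apply: (iff_trans (gamma_ir_eq_card_sub1 G_gt0)).
split=> [[[r r_gt0 /(regular_off_isolatedP _ r_gt0)[t isoG]] |] |
         [t [r [r_gt0 isoG]]]].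
- by exists t, r; split=> //; right.
- by move=> /star_off_isolatedP[t [r [r_gt0 isoG]]]; exists t, r; split=> //; left.
- case: isoG => isoG; first by right; apply/star_off_isolatedP; exists t, r.
  by left; exists r => //; apply/(regular_off_isolatedP _ r_gt0); exists t.
Qed.
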